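(* For all integers $n>0$ and $R\ge 0$, $k^+[n,R]=k^{\pm}[n,R]=k^-[n,R]=\max\{1,n-R\}$.
   Context: $Q_n=\{0,1\}^n$ is identified with the vector space $\mathbb{F}_2^n$ and is ordered by $x\preceq y$ iff $x_i\le y_i$ for all $i$; $d(x,y)$ is the Hamming distance and $\hat 1=(1,\dots,1)$. The downward directed ball is $B_n^-(x,R)=\{y\in Q_n: y\preceq x,\ d(x,y)\le R\}$. A set $\mathcal{C}\subseteq Q_n$ downward $R$-covers $Q_n$ if $Q_n=\bigcup_{c\in\mathcal{C}}B_n^-(c,R)$. The 1's complement of $\mathcal{C}$ is $\bar{\mathcal{C}}=\{\hat 1-x: x\in\mathcal{C}\}$. An $[n,R]^+$-code is a vector subspace $\mathcal{C}$ of $\mathbb{F}_2^n$ that downward $R$-covers $Q_n$. An $[n,R]^-$-code is a set $\mathcal{C}\subseteq Q_n$ whose 1's complement $\bar{\mathcal{C}}$ is an $[n,R]^+$-code. (Any downward covering set contains $\hat 1$, so such a $\mathcal{C}$ is again a subspace and its dimension makes sense.) An $[n,R]^{\pm}$-code is an $[n,R]^+$-code $\mathcal{C}$ that is self-complementary, i.e. $\mathcal{C}=\bar{\mathcal{C}}$. $k^+[n,R]$, $k^-[n,R]$, $k^{\pm}[n,R]$ denote the minimum dimension of an $[n,R]^+$-code, an $[n,R]^-$-code, and an $[n,R]^{\pm}$-code, respectively. *)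

(* Defs.v *)
From HB Require Import structures.
From mathcomp Require Import all_boot all_order all_algebra.

Set Implicit Arguments.
Unset Strict Implicit.
Unset Printing Implicit Defensive.

Import GRing.Theory.
Local Open Scope ring_scope.

(* Q_n = {0,1}^n, identified with the row vectors over F_2. *)
Notation cube n := 'rV['F_2]_n.

Section Cube.
Variable n : nat.
Implicit Types (x y : cube n) (C : {set cube n}) (R : nat).

Definition one_hat : cube n := const_mx 1.

(* Entries are compared as the naturals 0 and 1, via 'F_2 >-> nat. *)
Definition cube_le x y := [forall i, (x 0%R i <= y 0%R i)%N].

Definition hamming x y : nat := #|[set i | x 0 i != y 0 i]|.

Definition down_ball x R : {set cube n} :=
  [set y | cube_le y x & (hamming x y <= R)%N].

Definition down_covers R C := \bigcup_(c in C) down_ball c R == [set: cube n].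

Definition ones_compl C : {set cube n} := [set one_hat - x | x in C].

(* Boolean form of the library's submod_closed; see is_subspaceP. *)
Definition is_subspace C :=
  (0 \in C) &&
  [forall a : 'F_2, forall x in C, forall y in C, a *: x + y \in C].

Definition plus_code R C := is_subspace C && down_covers R C.
Definition minus_code R C := plus_code R (ones_compl C).
Definition pm_code R C := plus_code R C && (C == ones_compl C).

(* Dimension of the span of C: it is the dimension of C when C is a          *)
(* subspace, which is the case for the three kinds of codes                  *)
(* (minus_code_subspace for the non-obvious one).                            *)
Definition code_dim C : nat := \dim <<enum C>>%VS.

Lemma is_subspaceP C : reflect (submod_closed (mem C)) (is_subspace C).
Proof.
apply: (iffP andP) => [[C0 CL]|[C0 CL]]; split=> //.
  by move=> a x y Cx Cy; exact: (forall_inP (forall_inP (forallP CL a) _ Cx)).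
by apply/forallP=> a; apply/forall_inP=> x Cx; apply/forall_inP=> y; apply: CL.
Qed.

Lemma mem_span_subspace C : is_subspace C -> <<enum C>>%VS =i C.
Proof.
move=> /is_subspaceP[C0 CL] x; apply/idP/idP => [|Cx]; last first.
  by rewrite memv_span ?mem_enum.
move/(@coord_span _ _ _ (in_tuple (enum C)))=> ->.
apply: (big_ind (fun u => u \in C)) => [|u v Cu Cv|i _]; first exact: C0.
  by rewrite -[u]scale1r; apply: CL.
have Ci : (in_tuple (enum C))`_i \in C by rewrite -mem_enum mem_nth.
by rewrite -[_ *: _]addr0; apply: CL.
Qed.

Lemma one_hat_covers R C : down_covers R C -> one_hat \in C.
Proof.
move=> /eqP covC; have : one_hat \in [set: cube n] by rewrite inE.
rewrite -covC => /bigcupP[c Cc]; rewrite inE => /andP[/forallP le1c _].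
suff <- : c = one_hat by [].
apply/rowP=> i; rewrite mxE; apply/val_inj/eqP.
have := le1c i; rewrite mxE /=.
by case: (c 0 i) => -[|[|?]].
Qed.

Lemma ones_complK : involutive ones_compl.
Proof.
move=> C; rewrite /ones_compl -imset_comp -[RHS]imset_id.
by apply: eq_imset => x /=; rewrite opprB addrCA subrr addr0.
Qed.

Lemma plus_code_compl R C : plus_code R C -> ones_compl C = C.
Proof.
case/andP=> /is_subspaceP[_ CL] /one_hat_covers C1.
have CB x : x \in C -> one_hat - x \in C.
  by move=> Cx; rewrite addrC -scaleN1r; apply: CL.
apply/setP=> x; apply/imsetP/idP => [[y Cy ->]|Cx]; first exact: CB.
by exists (one_hat - x); rewrite ?CB // opprB addrCA subrr addr0.
Qed.

Lemma minus_code_subspace R C : minus_code R C -> is_subspace C.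
Proof.
move=> mC; have [sC _] := andP mC.
by rewrite -[C]ones_complK (plus_code_compl mC).
Qed.

Lemma plus_code_setT R : plus_code R [set: cube n].
Proof.
rewrite /plus_code; apply/andP; split.
  by apply/is_subspaceP; split=> [|a x y _ _]; rewrite inE.
apply/eqP/setP=> x; rewrite inE; apply/bigcupP; exists x; rewrite ?inE //.
apply/andP; split; first exact/forallP.
by rewrite /hamming (eq_card (B := pred0)) ?card0 // => i; rewrite !inE eqxx.
Qed.

Definition has_code_of_dim (P : pred {set cube n}) : pred nat :=
  fun d => [exists C, P C && (code_dim C == d)].

Lemma ex_dim (P : pred {set cube n}) C : P C -> exists d, has_code_of_dim P d.
Proof. by move=> PC; exists (code_dim C); apply/existsP; exists C; rewrite PC /=.
Qed.

Lemma plus_code_exists R : exists d, has_code_of_dim (plus_code R) d.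
Proof. exact: ex_dim (plus_code_setT R). Qed.

Lemma minus_code_exists R : exists d, has_code_of_dim (minus_code R) d.
Proof.
apply: (@ex_dim _ setT); rewrite /minus_code (plus_code_compl (plus_code_setT R)).
exact: plus_code_setT.
Qed.

Lemma pm_code_exists R : exists d, has_code_of_dim (pm_code R) d.
Proof.
apply: (@ex_dim _ setT); rewrite /pm_code (plus_code_compl (plus_code_setT R)) eqxx andbT.
exact: plus_code_setT.
Qed.

End Cube.

Definition k_plus (n R : nat) : nat := ex_minn (plus_code_exists n R).
Definition k_minus (n R : nat) : nat := ex_minn (minus_code_exists n R).
Definition k_pm (n R : nat) : nat := ex_minn (pm_code_exists n R).

(* Main.v *)
(** Every plus-code is self-complementary, so the three kinds of codes are the
    same sets, and only the least dimension of a plus-code matters.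

    Lower bound: a subspace [C] of dimension [k] has an information set, i.e. a
    set [I] of at most [k] coordinates such that only [0 \in C] vanishes on [I].
    The indicator vector of [I] lies below no codeword other than the all-ones
    vector, at distance [n - #|I|], so [n - k <= R]. Also [k > 0], since the
    all-ones vector is a codeword.

    Upper bound: the vectors that are constant on the first [R + 1] coordinates
    form a subspace of dimension [max(1, n - R)].  It covers [y]: either [y]
    already vanishes on that block, or at most [R] entries have to be raised. *)

Require Import Defs.
From mathcomp Require Import all_boot all_order all_algebra.

Set Implicit Arguments.
Unset Strict Implicit.
Unset Printing Implicit Defensive.

Import GRing.Theory.
Local Open Scope ring_scope.

Lemma F2_val_gt0 (a : 'F_2) : (0 < a)%N = (a == 1).
Proof. by case: a => -[|[|?]]. Qed.

Lemma card_ord_le n R : (#|[set i : 'I_n | (i <= R)%N]| <= R.+1)%N.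
Proof.
pose f (i : 'I_n) : 'I_R.+1 := inord i.
rewrite -[leqRHS]card_ord -(card_in_imset (f := f)) ?max_card //.
move=> i1 i2; rewrite !inE => le1 le2 /(congr1 val).
by rewrite /= !inordK // => /val_inj.
Qed.

(** The columns of [A] are a basis of [U], and [I] indexes a maximal independent set of its rows.
    Every row is a combination of these, so every entry of [x] is a combination of its entries on
    [I]. *)
Lemma information_set (F : fieldType) n (U : {vspace 'rV[F]_n}) :
  exists2 I : {set 'I_n}, (#|I| <= \dim U)%N &
    forall x, x \in U -> (forall i, i \in I -> x 0 i = 0) -> x = 0.
Proof.
pose B := vbasis U.
pose A : 'M[F]_(n, \dim U) := \matrix_(i, j) B`_j 0 i.
exists [set maxrankfun A j | j in 'I_(\rank A)] => [|x Ux x0].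
  by rewrite (leq_trans (leq_imset_card _ _)) // card_ord rank_leq_col.
have xE : x^T = A *m \col_j coord B j x.
  apply/colP=> i; rewrite {1}(coord_vbasis Ux) !mxE summxE.
  by apply: eq_bigr => j _; rewrite !mxE mulrC.
have /submxP[P AE] : (A <= rowsub (maxrankfun A) A)%MS by rewrite eq_maxrowsub.
apply: trmx_inj; rewrite trmx0 xE AE -mulmxA mul_rowsub_mx -xE.
rewrite (_ : rowsub _ _ = 0) ?mulmx0 //; apply/colP=> j.
by rewrite !mxE x0 // imset_f.
Qed.

Lemma plus_code_dim_ge n R (C : {set cube n}) : (0 < n)%N ->
  plus_code R C -> (maxn 1 (n - R) <= code_dim C)%N.
Proof.
move=> n_gt0 /andP[sC covC]; have C1 := one_hat_covers covC.
rewrite geq_max; apply/andP; split.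
  rewrite lt0n dimv_eq0; apply: contraTneq C1 => spanC0.
  rewrite -(mem_span_subspace sC) spanC0 memv0; apply/eqP.
  by move/rowP/(_ (Ordinal n_gt0))/eqP; rewrite !mxE oner_eq0.
have [I cardI I0] := information_set <<enum C>>%VS.
pose y : cube n := \row_i (i \in I)%:R.
have /bigcupP[c Cc] : y \in \bigcup_(c in C) down_ball c R.
  by rewrite (eqP covC) inE.
rewrite inE => /andP[/forallP le_yc dist_cy].
(* [c - one_hat n] is a codeword that vanishes on [I], since [c] lies above [y]. *)
have cE : c = one_hat n.
  apply/eqP; rewrite -subr_eq0; apply/eqP/I0 => [|i Ii].
    by rewrite memvB ?mem_span_subspace.
  have := le_yc i; rewrite !mxE Ii F2_val_gt0 => /eqP->.
  by rewrite subrr.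
rewrite leq_subCl (leq_trans _ dist_cy) // (leq_trans (leq_sub2l _ cardI)) //.
have <- : #|~: I| = (n - #|I|)%N by rewrite cardsCs setCK card_ord.
apply/subset_leq_card/subsetP=> i; rewrite !inE cE !mxE => /negPf->.
by rewrite oner_eq0.
Qed.

(* The coordinates [0, ..., R] are merged into one; when [n <= R.+1] only the
   constant vectors remain. *)
Fact merge_ord_subproof n R (i : 'I_n) : (i - R < maxn 1 (n - R))%N.
Proof.
rewrite leq_max; case: (leqP i R) => [/eqP->//|ltRi].
by rewrite ltn_sub2r ?orbT // (ltn_trans ltRi).
Qed.

Definition merge_ord n R (i : 'I_n) := Ordinal (merge_ord_subproof R i).

Definition merge_space n R : {vspace cube n} :=
  limg (linfun (colsub (@merge_ord n R) : cube (maxn 1 (n - R)) -> cube n)).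

Definition merge_code n R : {set cube n} := [set x | x \in merge_space n R].

Lemma dim_merge_code n R : (code_dim (merge_code n R) <= maxn 1 (n - R))%N.
Proof.
apply: (@leq_trans (\dim (merge_space n R))).
  by apply/dimvS/span_subvP=> x; rewrite mem_enum inE.
rewrite /merge_space; set f := linfun _.
have := leq_addl (\dim (fullv :&: lker f)) (\dim (limg f)).
by rewrite limg_ker_dim dimvf /dim /= mul1n.
Qed.

Lemma merge_ord_eq n R (i j : 'I_n) :
  merge_ord R i = merge_ord R j -> i != j -> (i <= R)%N.
Proof.
move=> /(congr1 val) /= ij; apply: contraNT; rewrite -ltnNge => ltRi.
have ltRj : (R < j)%N by rewrite -subn_gt0 -ij subn_gt0.
by apply/eqP/val_inj; rewrite /= -(subnK (ltnW ltRi)) ij subnK // ltnW.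
Qed.

Lemma plus_code_merge n R : plus_code R (merge_code n R).
Proof.
apply/andP; split.
  apply/is_subspaceP; split=> [|a x y]; rewrite !inE ?mem0v // => Ux Uy.
  by rewrite memvD ?memvZ.
rewrite /down_covers eqEsubset subsetT; apply/subsetP=> y _.
(* Taking the maximum of [y] over each merged class makes [c] the least codeword above [y]. *)
pose z : cube (maxn 1 (n - R)) :=
  \row_j [exists i, (merge_ord R i == j) && (y 0 i == 1)]%:R.
pose c := colsub (@merge_ord n R) z.
have y_neq1 i : y 0 i != 1 -> y 0 i = 0.
  by rewrite -F2_val_gt0 -eqn0Ngt => /eqP y0; apply/val_inj.
have cE i : y 0 i = 1 -> c 0 i = 1.
  move=> yi; rewrite !mxE; case: existsP => // -[].
  by exists i; rewrite yi !eqxx.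
apply/bigcupP; exists c.
  by rewrite inE; apply/memv_imgP; exists z; rewrite ?memvf // lfunE.
rewrite inE; apply/andP; split.
  apply/forallP=> i; have [yi|/y_neq1->//] := eqVneq (y 0 i) 1.
  by rewrite cE // yi.
rewrite /hamming; set D := [set i | _].
(* A raised entry [i] shares its class with some [j] where [y] is already 1. Hence a nonempty [D] is
   a proper subset of the block of at most [R.+1] coordinates, which saves the one needed for the
   radius [R]. *)
have DP i : i \in D -> exists j, [/\ j \notin D, (j <= R)%N & (i <= R)%N].
  rewrite inE => Di; have yi : y 0 i != 1.
    by apply: contraNneq Di => yi; rewrite cE // yi.
  move: Di; rewrite !mxE (y_neq1 _ yi); case: existsP; rewrite ?eqxx //.
  case=> j /andP[/eqP ji /eqP yj] _.
  have neq_ji : j != i by apply: contraNneq yi => <-; apply/eqP.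
  exists j; split.
  - by rewrite inE cE // yj eqxx.
  - exact: merge_ord_eq ji neq_ji.
  - by apply: (@merge_ord_eq _ _ i j); rewrite // eq_sym.
have [->|[i /DP[j [Dj leRj _]]]] := set_0Vmem D; first by rewrite cards0.
rewrite -ltnS; apply: leq_trans (card_ord_le n R); apply: proper_card.
apply/properP; split; last by exists j; rewrite // inE.
by apply/subsetP=> k /DP[_ [_ _ leRk]]; rewrite inE.
Qed.

Theorem theorem19 (n R : nat) (hn : (0 < n)%N) :
  k_plus n R = k_pm n R /\
  k_pm n R = k_minus n R /\
  k_minus n R = maxn 1 (n - R).
Proof.
have k_pmE : k_pm n R = k_plus n R.
  apply: eq_ex_minn => d; apply: eq_existsb => C; congr (_ && _).
  by apply/andP/idP => [[]//|plusC]; rewrite (plus_code_compl plusC).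
have k_minusE : k_minus n R = k_plus n R.
  apply: eq_ex_minn => d; apply: eq_existsb => C; congr (_ && _).
  apply/idP/idP => plusC; last by rewrite /minus_code (plus_code_compl plusC).
  by rewrite -[C]ones_complK (plus_code_compl plusC).
rewrite k_pmE k_minusE; split=> //; split=> //; rewrite /k_plus.
case: ex_minnP => k /existsP[C /andP[plusC /eqP <-]] min_k.
apply/eqP; rewrite eqn_leq plus_code_dim_ge // andbT.
rewrite (leq_trans _ (dim_merge_code n R)) // min_k //.
by apply/existsP; exists (merge_code n R); rewrite plus_code_merge /=.
Qed.
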